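(* Let $E=(E^0,E^1,r,s)$ be a topological graph. Then $\partial E=\partial_Y E$, i.e. the set $\partial E=E^\infty\amalg\{\mu\in E^*: s(\mu)\in E^0_{\mathrm{sg}}\}$ of boundary paths coincides with the set $\partial_Y E\subset E^*\amalg E^\infty$ of boundary paths in the sense of Yeend.
   Context: A topological graph is a quadruple $E=(E^0,E^1,r,s)$ with $E^0,E^1$ locally compact Hausdorff spaces, $r:E^1\to E^0$ continuous and $s:E^1\to E^0$ a local homeomorphism. Let $E^0_{\mathrm{fin}}$ be the set of $v\in E^0$ having an open neighborhood $N$ with $r^{-1}(\overline N)\subset E^1$ compact; $E^0_{\mathrm{sce}}:=E^0\setminus\overline{r(E^1)}$; $E^0_{\mathrm{rg}}:=E^0_{\mathrm{fin}}\setminus\overline{E^0_{\mathrm{sce}}}$; $E^0_{\mathrm{sg}}:=E^0\setminus E^0_{\mathrm{rg}}$. For $n\ge 2$, $E^n:=\{(\mu_1,\dots,\mu_n)\in\prod_{i=1}^nE^1: s(\mu_i)=r(\mu_{i+1})\}$ with the subspace topology of the product; $E^*:=\coprod_{n\ge 0}E^n$ with the disjoint union topology; $r(\mu)=r(\mu_1)$, $s(\mu)=s(\mu_n)$ for $\mu\in E^n$, $n\ge1$, and $r=s=\mathrm{id}$ on $E^0$. $E^\infty:=\{\mu\in\prod_{i=1}^\infty E^1: s(\mu_i)=r(\mu_{i+1})\text{ for all }i\}$. $|\mu|$ denotes the length of a path $\mu$. Exhaustive sets. For $V\subset E^0$, a set $U\subset r^{-1}(V)\subset E^*$ is exhaustive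 for $V$ if for every $\lambda\in E^*$ with $r(\lambda)\in V$ there is $\alpha\in U$ such that $\lambda=\alpha\beta$ or $\alpha=\lambda\beta$ for some $\beta\in E^*$. Boundary paths in the sense of Yeend. An infinite path $\mu\in E^\infty$ belongs to $\partial_YE$ if for every $m\ge0$ and every compact $K\subset E^*$ such that $r(K)$ is a neighborhood of $r(\mu_{m+1})$ and $K$ is exhaustive for $r(K)$, at least one path in $\{r(\mu_{m+1}),\mu_{m+1},\mu_{m+1}\mu_{m+2},\dots\}$ lies in $K$. A finite path $\mu\in E^*$ belongs to $\partial_YE$ if both: (i) for every $0\le m<|\mu|$ and every compact $K\subset E^*$ such that $r(K)$ is a neighborhood of $r(\mu_{m+1})$ and $K$ is exhaustive for $r(K)$, at least one path in $\{r(\mu_{m+1}),\mu_{m+1},\dots,\mu_{m+1}\cdots\mu_{|\mu|}\}$ lies in $K$; and (ii) (the case $m=|\mu|$) for every compact $K\subset E^*$ such that $r(K)$ is a neighborhood of $s(\mu)$ and $K$ is exhaustive for $r(K)$, one has $s(\mu)\in K$. *)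

(* Defs.v *)
From HB Require Import structures.
From mathcomp Require Import all_boot all_order all_algebra.
From mathcomp Require Import all_classical all_reals topology.

Set Implicit Arguments.
Unset Strict Implicit.
Unset Printing Implicit Defensive.

Local Open Scope classical_set_scope.

(* The function [g] is only relevant on [f @` U], where it is the inverse
   homeomorphism. *)
Definition local_homeomorphism (X Y : topologicalType) (f : X -> Y) : Prop :=
  forall x : X, exists U : set X, [/\ open U, U x, open (f @` U) &
    exists g : Y -> X, [/\ {in U, cancel f g},
      {within U, continuous f} & {within f @` U, continuous g}]].

Record topological_graph := TopologicalGraph {
  vertex : topologicalType;
  edge : topologicalType;
  er : edge -> vertex;
  es : edge -> vertex;
  vertex_hausdorff : hausdorff_space vertex;
  vertex_locally_compact : locally_compact [set: vertex];
  edge_hausdorff : hausdorff_space edge;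
  edge_locally_compact : locally_compact [set: edge];
  er_continuous : continuous er;
  es_local_homeomorphism : local_homeomorphism es
}.

Section Defs.
Variable E : topological_graph.

Definition E0fin : set (vertex E) :=
  [set v | exists N : set (vertex E),
     [/\ open N, N v & compact (@er E @^-1` closure N)]].

Definition E0sce : set (vertex E) := ~` closure (range (@er E)).

Definition E0rg : set (vertex E) := E0fin `\` closure E0sce.

Definition E0sg : set (vertex E) := ~` E0rg.

(* A path of length n.+1 is a family p_0, ..., p_n of edges, so the edge p_i is
   written mu_(i+1) on paper.  E^1 appears as the space of 1-tuples of edges. *)
Definition composable n : set {ptws 'I_n.+1 -> edge E} :=
  [set p | forall i j : 'I_n.+1, j = i.+1 :> nat -> es (p i) = er (p j)].

Definition npath (n : nat) : topologicalType :=
  match n with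
  | 0 => vertex E
  | n'.+1 => set_type (@composable n')
  end.

(* E^*, with the disjoint union topology *)
Definition finpath : topologicalType := {n : nat & npath n}.

Definition plen (mu : finpath) : nat := projT1 mu.

Definition prange (mu : finpath) : vertex E :=
  match mu with
  | existT n p =>
    match n return npath n -> vertex E with
    | 0 => id
    | n'.+1 => fun p => er (set_val p ord0)
    end p
  end.

Definition psource (mu : finpath) : vertex E :=
  match mu with
  | existT n p =>
    match n return npath n -> vertex E with
    | 0 => id
    | n'.+1 => fun p => es (set_val p ord_max)
    end p
  end.

Definition pedge (mu : finpath) : 'I_(plen mu) -> edge E :=
  match mu return 'I_(plen mu) -> edge E with
  | existT n p =>
    match n return npath n -> 'I_n -> edge E with
    | 0 => fun _ i => False_rect _ (notF (ltn_ord i))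
    | n'.+1 => fun p => set_val p
    end p
  end.

Definition pedges (mu : finpath) : seq (edge E) :=
  [seq pedge i | i <- enum 'I_(plen mu)].

(* [is_path v l lam]: lam is the path e_1 ... e_k with l = [:: e_1; ...; e_k],
   and the vertex v if l is empty.  There is at most one such lam
   ([is_path_inj]), and one exists whenever the edges of l are composable and
   start at v ([is_path_ex]). *)
Definition is_path (v : vertex E) (l : seq (edge E)) (lam : finpath) : Prop :=
  prange lam = v /\ pedges lam = l.

(* [is_concat al be lam]: al and be are composable and lam = al be *)
Definition is_concat (al be lam : finpath) : Prop :=
  psource al = prange be /\
  is_path (prange al) (pedges al ++ pedges be) lam.

(* E^oo; the edge mu i is written mu_(i+1) on paper *)
Definition infpath : Type :=
  {mu : nat -> edge E | forall i, es (mu i) = er (mu i.+1)}.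

Definition boundary : set (finpath + infpath) :=
  range inr `|` inl @` [set mu : finpath | E0sg (psource mu)].

Definition exhaustive (V : set (vertex E)) (U : set finpath) : Prop :=
  U `<=` prange @^-1` V /\
  forall lam : finpath, V (prange lam) ->
    exists2 al : finpath, U al &
      exists be : finpath, is_concat al be lam \/ is_concat lam be al.

Definition exhaustive_at (v : vertex E) (K : set finpath) : Prop :=
  [/\ compact K, nbhs v (prange @` K) & exhaustive (prange @` K) K].

Definition Yeend_infinite (mu : infpath) : Prop :=
  forall (m : nat) (K : set finpath), exhaustive_at (er (sval mu m)) K ->
    exists2 lam : finpath, K lam &
      exists k : nat,
        is_path (er (sval mu m)) (mkseq (fun i => sval mu (m + i)) k) lam.

Definition Yeend_finite (mu : finpath) : Prop :=
  (forall (m : 'I_(plen mu)) (K : set finpath), exhaustive_at (er (pedge m)) K ->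
     exists2 lam : finpath, K lam &
       exists2 k : nat, m + k <= plen mu &
         is_path (er (pedge m)) (take k (drop m (pedges mu))) lam) /\
  (forall K : set finpath, exhaustive_at (psource mu) K ->
     K (existT npath 0 (psource mu))).

Definition boundaryY : set (finpath + infpath) :=
  [set x | match x with
           | inl mu => Yeend_finite mu
           | inr mu => Yeend_infinite mu
           end].

Lemma size_pedges (mu : finpath) : size (pedges mu) = plen mu.
Proof. by rewrite size_map size_enum_ord. Qed.

Lemma nth_pedges e0 (mu : finpath) (i : 'I_(plen mu)) :
  nth e0 (pedges mu) i = pedge i.
Proof. by rewrite (nth_map i) ?size_enum_ord// nth_ord_enum. Qed.

Arguments nth_pedges : clear implicits.

Lemma is_path_inj v l (lam lam' : finpath) :
  is_path v l lam -> is_path v l lam' -> lam = lam'.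
Proof.
case=> <- <- [].
case: lam => n p; case: lam' => n' p' rE eE.
have nE : n' = n.
  by have := congr1 size eE; rewrite !size_pedges.
subst n'; case: n p p' rE eE => [|n] p p' rE eE; first by rewrite -[p]rE.
congr existT; apply/val_inj/funext => i.
have e0 := set_val p i.
have := nth_pedges e0 (existT npath n.+1 p) i.
by rewrite -eE (nth_pedges e0 (existT npath n.+1 p') i).
Qed.

Lemma is_path_ex v (l : seq (edge E)) :
  (forall e l', l = e :: l' -> er e = v) ->
  (forall e0 i, i.+1 < size l -> es (nth e0 l i) = er (nth e0 l i.+1)) ->
  exists lam, is_path v l lam.
Proof.
case: l => [_ _|e l hv hc].
  exists (existT npath 0 v); split => //.
  by apply: size0nil; rewrite size_pedges.
pose p : {ptws 'I_(size l).+1 -> edge E} := fun i => nth e (e :: l) i.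
have cp : composable p.
  by move=> i j ji; rewrite /p ji; apply: hc; rewrite /= -ji.
exists (existT npath (size l).+1 (SigSub (mem_set cp))); split.
  exact: (hv e l).
apply: (@eq_from_nth _ e); first by rewrite size_pedges.
rewrite size_pedges => i ilt.
by rewrite (nth_pedges e _ (Ordinal ilt)).
Qed.

Lemma pedges_head (mu : finpath) e l : pedges mu = e :: l -> er e = prange mu.
Proof.
case: mu => -[|n] p; first by move/(congr1 size); rewrite size_pedges.
have := nth_pedges e (existT npath n.+1 p) ord0.
by move=> /[swap] -> /= ->.
Qed.

Lemma pedges_nth e0 (mu : finpath) i : i.+1 < plen mu ->
  es (nth e0 (pedges mu) i) = er (nth e0 (pedges mu) i.+1).
Proof.
case: mu => -[|n] p // h.
rewrite (nth_pedges e0 (existT npath n.+1 p) (Ordinal h)).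
rewrite (nth_pedges e0 (existT npath n.+1 p) (Ordinal (ltnW h))).
by have /set_mem := valP p; apply.
Qed.

Lemma pedges_last e0 (mu : finpath) : 0 < plen mu ->
  es (nth e0 (pedges mu) (plen mu).-1) = psource mu.
Proof.
case: mu => -[|n] p // _.
by rewrite (nth_pedges e0 (existT npath n.+1 p) ord_max).
Qed.

Lemma is_concat_ex (al be : finpath) : psource al = prange be ->
  exists lam, is_concat al be lam.
Proof.
move=> ab; suff [lam] : exists lam, is_path (prange al) (pedges al ++ pedges be) lam.
  by exists lam.
apply: is_path_ex => [e l|e0 i].
  case E1 : (pedges al) => [|e' l'] /=.
    move=> /pedges_head ->; rewrite -ab; case: al {ab} E1 => -[|n] p //.
    by move/(congr1 size); rewrite size_pedges.
  by case=> <- _; exact: pedges_head E1.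
rewrite size_cat !size_pedges => ilt.
case: (ltngtP i.+1 (plen al)) => ia; rewrite !nth_cat !size_pedges.
- have lt1 : i < plen al by exact: leq_trans (leqnSn _) ia.
  by rewrite lt1 ia pedges_nth.
- have le_i : (plen al <= i)%N := ia.
  have lt1 : (i < plen al) = false by rewrite ltnNge le_i.
  have lt2 : (i.+1 < plen al) = false by rewrite ltnNge leqW.
  rewrite lt1 lt2 subSn// pedges_nth//.
  by rewrite -subSn// ltn_subLR// leqW// ltnW.
- rewrite -ia ltnSn ltnn subnn.
  have -> : i = (plen al).-1 by rewrite -ia.
  rewrite pedges_last -?ia// ab.
  case E1 : (pedges be) => [|e l] /=; last by rewrite (pedges_head E1).
  by move: ilt; rewrite -(size_pedges be) E1 addn0 ia ltnn.
Qed.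

End Defs.

Arguments boundary : clear implicits.
Arguments boundaryY : clear implicits.

(* Main.v *)
(* If v is singular and K is a compact exhaustive set over a neighbourhood of
   v with v not in K, then near v every vertex of r(K) is the range of an
   edge, so v is not in the closure of E^0_sce, and all edges ending near v
   are first edges of paths in K, so v is in E^0_fin: a contradiction. If
   instead K is exhaustive at the range of a path e lam with singular source,
   some initial part of e lam is in K: choose a closed neighbourhood W of e
   on which s is injective; unless r(e) is in K, the set of all paths beta
   with e' beta in K for some e' in W is again compact and exhaustive over a
   neighbourhood of s(e), and induction on the length applies. Conversely,
   over a regular vertex v the edges ending in a small closed neighbourhood
   of v form a compact exhaustive set avoiding v. Infinite paths are always
   in the boundary because a compact set of paths has bounded length. *)

Require Import Defs.
From mathcomp Require Import all_boot all_order all_algebra.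
From mathcomp Require Import all_classical all_reals topology.

Set Implicit Arguments.
Unset Strict Implicit.
Unset Printing Implicit Defensive.

Local Open Scope classical_set_scope.

(** * Locally compact Hausdorff spaces and local homeomorphisms *)

Lemma locally_compact_nbhs_closure (T : topologicalType) (x : T) (O : set T) :
  hausdorff_space T -> locally_compact [set: T] -> nbhs x O ->
  exists V, [/\ open V, V x & closure V `<=` O].
Proof.
move=> hT /(_ x I)[C xC [cC _]] xO.
have {}xC : nbhs x C
  by move: xC; rewrite /within /=; apply: filterS => y /(_ I).
have [V xV VO] := compact_regular hT cC xC xO.
exists V°; split; first exact: open_interior.
  exact: xV.
exact: subset_trans (closureS (@interior_subset _ V)) VO.
Qed.

(** The local inverse [g] is continuous on the open set f(U) and pulls [W] back to a neighbourhood
    contained in f(W). *)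
Lemma local_homeomorphism_nbhs (X Y : topologicalType) (f : X -> Y) (x : X)
    (W : set X) :
  local_homeomorphism f -> nbhs x W -> nbhs (f x) (f @` W).
Proof.
move=> /(_ x)[U [oU Ux ofU [g [gK _ cg]]]] xW.
have fUx : (f @` U) (f x) by exists x.
have : (f @` U) `&` g @^-1` W `<=` f @` W.
  by move=> _ [[y Uy <-]]; rewrite /= gK ?inE// => Wy; exists y.
move/filterS; apply; apply: filterI; first exact: open_nbhs_nbhs.
move: cg; rewrite continuous_open_subspace// => /(_ _ (mem_set fUx) W).
by rewrite gK ?inE//; apply.
Qed.

Lemma local_homeomorphism_inj (X Y : topologicalType) (f : X -> Y) (x : X) :
  local_homeomorphism f -> exists2 U, nbhs x U & {in U &, injective f}.
Proof.
move=> /(_ x)[U [oU Ux _ [g [gK _ _]]]]; exists U; first exact: open_nbhs_nbhs.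
exact: can_in_inj gK.
Qed.

Section BoundaryPaths.
Variable E : topological_graph.
Implicit Types (mu al be lam : finpath E) (e : edge E) (v w : vertex E).
Implicit Types K : set (finpath E).

Local Notation vpath v := (existT (@npath E) 0 v).

(** * Concatenation in terms of edge lists *)

Lemma pedges_vpath v : pedges (vpath v) = [::].
Proof. by apply: size0nil; rewrite size_pedges. Qed.

Lemma pedges_nil mu : pedges mu = [::] -> mu = vpath (prange mu).
Proof. by case: mu => -[|n] p // /(congr1 size); rewrite size_pedges. Qed.

Lemma is_concat_pedges al be lam : is_concat al be lam ->
  prange al = prange lam /\ exists l, pedges lam = pedges al ++ l.
Proof. by case=> _ [-> ->]; split=> //; exists (pedges be). Qed.

(** Converse of [is_concat_pedges]: as [lam] is composable where [al] ends, the leftover edges [l]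
    form a path starting at the source of [al]. *)
Lemma pedges_cat_concat al lam l :
  prange al = prange lam -> pedges lam = pedges al ++ l ->
  exists be, is_concat al be lam.
Proof.
move=> rE lE.
have sE e l' : l = e :: l' -> er e = psource al.
  move=> le; have plE : plen lam = (plen al + size l)%N.
    by rewrite -!size_pedges lE size_cat.
  case a0 : (plen al) => [|n].
    have al0 : pedges al = [::] by apply: size0nil; rewrite size_pedges.
    have -> : psource al = prange al by rewrite (pedges_nil al0).
    by rewrite rE; apply: (pedges_head (l := l')); rewrite lE al0.
  have nal : (n < plen al)%N by rewrite a0.
  have nlam : (n.+1 < plen lam)%N by rewrite plE a0 le /= addnS ltnS leq_addr.
  have := pedges_nth e nlam.
  rewrite lE !nth_cat size_pedges nal a0 ltnn subnn le /= => <-.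
  by rewrite -(@pedges_last E e) ?a0.
have [be [rbe ebe]] : exists be, is_path (psource al) l be.
  apply: is_path_ex => // e0 i il.
  have := @pedges_nth E e0 lam (plen al + i).
  rewrite -addnS lE !nth_cat size_pedges.
  rewrite !ltnNge !leq_addr /= !addKn -!ltnNge; apply.
  by rewrite -(size_pedges lam) lE size_cat size_pedges ltn_add2l.
by exists be; split; [rewrite rbe | split; rewrite ?ebe].
Qed.

(** * First edge, tail, and paths of length one *)

Definition phead e0 mu : edge E := head e0 (pedges mu).

Lemma phead_succ e0 n (p : npath E n.+1) :
  phead e0 (existT (@npath E) n.+1 p) = set_val p ord0.
Proof.
rewrite /phead -nth0.
by rewrite (@nth_pedges E e0 (existT (@npath E) n.+1 p) ord0).
Qed.

Lemma composable_shift n (p : 'I_n.+2 -> edge E) : composable p ->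
  composable (fun i : 'I_n.+1 => p (lift ord0 i)).
Proof. by move=> cp i j ij; apply: cp; rewrite !lift0 ij. Qed.

Definition nshift n (p : npath E n.+2) : npath E n.+1 :=
  SigSub (mem_set (composable_shift (set_mem (valP p)))).

(** Length one is a separate case because the tail is then a vertex, not a family of edges. Vertices
    are fixed, so that the source is preserved for every path. *)
Definition ptail mu : finpath E :=
  match mu with
  | existT n p =>
    match n return npath E n -> finpath E with
    | 0 => fun p => vpath p
    | 1 => fun p => vpath (es (set_val p ord0))
    | n'.+2 => fun p => existT (@npath E) n'.+1 (nshift p)
    end p
  end.

Lemma pedges_ptail mu : pedges (ptail mu) = behead (pedges mu).
Proof.
case: mu => -[|[|n]] p.
- by rewrite pedges_vpath.
- by rewrite pedges_vpath; apply/esym/size0nil; rewrite size_behead size_pedges.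
- have e0 := set_val p ord0.
  apply: (@eq_from_nth _ e0); first by rewrite size_behead !size_pedges.
  rewrite size_pedges => i /= ilt; rewrite nth_behead.
  rewrite (@nth_pedges E e0 (ptail (existT (@npath E) n.+2 p)) (Ordinal ilt)).
  have ilt' : (i.+1 < n.+2)%N by [].
  rewrite (@nth_pedges E e0 (existT (@npath E) n.+2 p) (Ordinal ilt')).
  by rewrite (_ : Ordinal ilt' = lift ord0 (Ordinal ilt)); last exact/val_inj.
Qed.

Lemma prange_ptail mu e l : pedges mu = e :: l -> prange (ptail mu) = es e.
Proof.
case: mu => -[|[|n]] p; first by rewrite pedges_vpath.
  move=> /(congr1 (head e)) /=.
  by rewrite -/(phead e _) phead_succ => ->.
move=> /(congr1 (head e)) /=; rewrite -/(phead e _) phead_succ => <-.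
by have /set_mem/(_ ord0 (lift ord0 ord0)) := valP p => <-.
Qed.

Lemma psource_ptail mu : psource (ptail mu) = psource mu.
Proof.
case: mu => -[|[|n]] p //=; congr (es (set_val p _)); exact/val_inj.
Qed.

Lemma composable1 (p : 'I_1 -> edge E) : composable p.
Proof. by move=> i j ij; have := ltn_ord j; rewrite ij. Qed.

Definition npath1 e : npath E 1 := SigSub (mem_set (@composable1 (fun=> e))).

Definition epath e : finpath E := existT (@npath E) 1 (npath1 e).

Lemma pedges_epath e : pedges (epath e) = [:: e].
Proof.
apply: (@eq_from_nth _ e); first by rewrite size_pedges.
rewrite size_pedges => i ilt.
by rewrite (@nth_pedges E e (epath e) (Ordinal ilt)); case: i ilt.
Qed.

(** * Continuity of the operations on paths *)

Lemma es_continuous : continuous (@es E).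
Proof.
move=> e; have [U [oU Ue _ [g [_ + _]]]] := es_local_homeomorphism e.
by rewrite continuous_open_subspace// => /(_ e (mem_set Ue)).
Qed.

Lemma set_val_continuous n (i : 'I_n.+1) :
  continuous (fun p : npath E n.+1 => set_val p i).
Proof.
move=> p.
apply: (@continuous_comp (npath E n.+1) {ptws 'I_n.+1 -> edge E} _ set_val
  (@proj _ (fun=> edge E) i)).
  exact: initial_continuous.
exact: proj_continuous.
Qed.

Lemma npath_continuous (T : topologicalType) n (f : T -> npath E n.+1) :
  (forall i, continuous (fun x => set_val (f x) i)) -> continuous f.
Proof.
move=> cf; apply: continuous_comp_initial => x.
apply/cvg_sup => i U [_ /= [[W oW <-]]] /= Wfx /filterS; apply.
by apply: (cf i); exact: open_nbhs_nbhs.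
Qed.

Lemma finpath_continuous (T : topologicalType) (f : finpath E -> T) :
  (forall n, continuous (fun p : npath E n => f (existT _ n p))) ->
  continuous f.
Proof. by move=> cf [n p] U; exact: cf. Qed.

Lemma prange_continuous : continuous (@prange E).
Proof.
apply: finpath_continuous => -[|n] p; first exact: cvg_id.
apply: (@continuous_comp _ _ _ (fun p : npath E n.+1 => set_val p ord0)).
  exact: set_val_continuous.
exact: er_continuous.
Qed.

(** Each length is a separate summand of E^*, so the default value [e0] on vertices does no harm to
    continuity. *)
Lemma phead_continuous e0 : continuous (phead e0).
Proof.
apply: finpath_continuous => -[|n].
  rewrite (_ : (fun _ => _) = fun=> e0); first exact: cst_continuous.
  by apply/funext => p; rewrite /phead pedges_vpath.
rewrite (_ : (fun _ => _) = fun p : npath E n.+1 => set_val p ord0).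
  exact: set_val_continuous.
by apply/funext => p; rewrite phead_succ.
Qed.

Lemma ptail_continuous : continuous ptail.
Proof.
apply: finpath_continuous => -[|[|n]].
- exact: existT_continuous.
- move=> p; apply: (@continuous_comp _ _ _
    (fun p : npath E 1 => es (set_val p ord0)) (existT (@npath E) 0)).
    apply: (@continuous_comp _ _ _ (fun p : npath E 1 => set_val p ord0)).
      exact: set_val_continuous.
    exact: es_continuous.
  exact: existT_continuous.
- move=> p.
  apply: (@continuous_comp _ _ _ (@nshift n) (existT (@npath E) n.+1)).
    apply: npath_continuous => i; exact: set_val_continuous.
  exact: existT_continuous.
Qed.

Lemma epath_continuous : continuous epath.
Proof.
move=> e; apply: (@continuous_comp _ _ _ npath1 (existT (@npath E) 1)).
  by apply: npath_continuous => i x; exact: cvg_id.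
exact: existT_continuous.
Qed.

Lemma plen_continuous : continuous (@plen E).
Proof. by apply: finpath_continuous => n; exact: cst_continuous. Qed.

(** * Compact and exhaustive sets of paths *)

Lemma compact_plen_bounded K : compact K ->
  exists n, forall mu, K mu -> (plen mu < n)%N.
Proof.
move=> cK; have : compact (@plen E @` K).
  by apply: continuous_compact cK; exact/continuous_subspaceT/plen_continuous.
(* Finitely many initial segments of the discrete space [nat] cover the lengths; the largest index
   is a bound. *)
rewrite compact_cover => /(_ nat setT (fun n => [set m | m < n]%N)).
case=> [n _|m _|D _ KD]; first exact: discrete_open.
  by exists m.+1 => //=.
exists (\max_(i <- finmap.enum_fset D) i)%N => mu Kmu.
have [|n /= nD mun] := KD (plen mu); first by exists mu.
exact: leq_trans mun (leq_bigmax_seq _ nD isT).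
Qed.

(** One path extends the other. The equality of ranges matters for vertices, whose edge list is
    empty. *)
Definition path_comparable al lam :=
  prange al = prange lam /\
  (prefix (pedges al) (pedges lam) || prefix (pedges lam) (pedges al)).

Lemma exhaustive_atP v K : exhaustive_at v K <->
  [/\ compact K, nbhs v (@prange E @` K) &
    forall lam, (@prange E @` K) (prange lam) ->
      exists2 al, K al & path_comparable al lam].
Proof.
split=> -[cK nK exK]; split=> //.
  move=> lam Klam.
  have [al Kal [be [|] /is_concat_pedges[rE lE]]] := exK.2 lam Klam;
    exists al => //; split=> //; apply/orP; [left|right]; exact/prefixP.
split=> [mu Kmu|lam Klam]; first by exists mu.
have [al Kal [rE lE]] := exK lam Klam; exists al => //.
by case/orP: lE => /prefixP[l lE];
  [have [be] := pedges_cat_concat rE lE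
  |have [be] := pedges_cat_concat (esym rE) lE];
  exists be; [left|right].
Qed.

(** This is the image under [prange] of the length-zero part of [K], hence compact in a Hausdorff
    space. *)
Lemma closed_vpaths K : compact K -> closed [set v | K (vpath v)].
Proof.
move=> cK; rewrite (_ : mkset _ = @prange E @` (K `&` @plen E @^-1` [set 0%N])).
  apply: compact_closed; first exact: vertex_hausdorff.
  apply: continuous_compact.
    exact/continuous_subspaceT/prange_continuous.
  apply: compact_closedI => //; apply: closed_comp; last exact: discrete_closed.
  by move=> mu _; exact: plen_continuous.
apply/seteqP; split=> [v Kv|_ [[[|n] p] [Kp //= _] <-]//].
by exists (vpath v).
Qed.

Lemma path_comparable_edge al lam e l :
  path_comparable al lam -> pedges lam = e :: l ->
  al = vpath (er e) \/ exists l', pedges al = e :: l'.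
Proof.
move=> [rE]; case al0 : (pedges al) => [|e' l'] + lamE; rewrite lamE.
  by left; rewrite (pedges_nil al0) rE -(pedges_head lamE).
by rewrite !prefix_cons => /orP[|] /andP[/eqP-> _]; right; exists l'.
Qed.

(** Over this neighbourhood every path of [K] has at least one edge. *)
Lemma nbhs_setD_vpath K v : exhaustive_at v K -> ~ K (vpath v) ->
  nbhs v ((@prange E @` K) `&` ~` [set w | K (vpath w)]).
Proof.
move=> [cK nK _] nKv; apply: filterI => //; apply: open_nbhs_nbhs; split=> //.
apply: closed_openC; exact: closed_vpaths.
Qed.

(** * Exhaustive sets at a singular vertex *)

Lemma compact_phead K e0 : compact K -> compact (phead e0 @` K).
Proof.
move=> cK; apply: continuous_compact => //.
exact/continuous_subspaceT/phead_continuous.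
Qed.

Lemma E0sg_vpath_mem K v : E0sg v -> exhaustive_at v K -> K (vpath v).
Proof.
move=> sgv exK; apply: contrapT => nKv; apply: sgv.
have /exhaustive_atP[cK nK exK'] := exK.
have [N [oN Nv NO]] := locally_compact_nbhs_closure (@vertex_hausdorff E)
  (@vertex_locally_compact E) (nbhs_setD_vpath exK nKv).
split; last first.
  (* A vertex of [E0sce] in [N] would be the range of a path in [K] with an edge, hence the range of
     that edge. *)
  move=> /(_ N (open_nbhs_nbhs (conj oN Nv)))[w [scew /subset_closure/NO]].
  case=> -[mu Kmu rmu]; apply; rewrite /= -rmu.
  case muE : (pedges mu) => [|e l]; first by rewrite -(pedges_nil muE).
  case: scew; apply: subset_closure; exists e => //.
  by rewrite -rmu (pedges_head muE).
exists N; split=> //.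
(* [phead] needs some edge as default value. *)
have [->|/set0P[e0 _]] := eqVneq (@er E @^-1` closure N) set0.
  exact: compact0.
apply: subclosed_compact (compact_phead (e0 := e0) cK) _.
  apply: closed_comp; last exact: closed_closure.
  by move=> e _; exact: er_continuous.
(* A path of [K] comparable with the single edge [e] is not the vertex r(e), so its first edge is
   [e]. *)
move=> e /= /NO[Ke nKe]; have := exK' (epath e) Ke.
case=> al Kal /path_comparable_edge/(_ (pedges_epath e))[alE|[l alE]].
  by case: nKe; rewrite /= -alE.
by exists al => //; rewrite /phead alE.
Qed.

(** * Removing first edges from an exhaustive set, and induction along a path *)

Definition edge_quotient K (W : set (edge E)) : set (finpath E) :=
  [set lam | exists2 mu, K mu & exists2 e, W e &
     pedges mu = e :: pedges lam /\ prange lam = es e].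

(** For closed [W] this is a continuous image of a closed part of [K], which gives compactness.
    Positive length makes the value of [phead] independent of [e0]. *)
Lemma edge_quotientE K W e0 : edge_quotient K W =
  ptail @` (K `&` (@plen E @^-1` [set n | 0 < n]%N `&` phead e0 @^-1` W)).
Proof.
apply/seteqP; split=> [lam [mu Kmu [e We [muE rlam]]]|].
  exists mu.
    split=> //; split; last by rewrite /= /phead muE.
    by rewrite /= -size_pedges muE.
  apply: (@is_path_inj _ (es e) (pedges lam)) => //; split.
    exact: prange_ptail muE.
  by rewrite pedges_ptail muE.
move=> _ [mu [Kmu [/= mu0 Wmu]] <-].
case muE : (pedges mu) mu0 Wmu => [|e l]; first by rewrite -size_pedges muE.
rewrite /phead muE /= => _ We; exists mu => //; exists e => //.
by rewrite pedges_ptail muE (prange_ptail muE).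
Qed.

Lemma compact_edge_quotient K W : compact K -> closed W ->
  compact (edge_quotient K W).
Proof.
move=> cK cW.
have [->|/set0P[_ [_ _ [e0 _ _]]]] := eqVneq (edge_quotient K W) set0.
  exact: compact0.
rewrite (edge_quotientE _ _ e0); apply: continuous_compact.
  exact/continuous_subspaceT/ptail_continuous.
apply: compact_closedI => //; apply: closedI; apply: closed_comp => //.
- by move=> mu _; exact: plen_continuous.
- exact: discrete_closed.
- by move=> mu _; exact: phead_continuous.
Qed.

(** For [e'] in [W] and [lam] starting at s(e'), some path of [K] is comparable with e' lam. It is
    not the vertex r(e'), so it begins with [e'], and removing [e'] from both keeps them comparable.
    The ranges so obtained contain s(W), a neighbourhood of s(e). *)
Lemma exhaustive_at_edge_quotient K W e : exhaustive_at (er e) K ->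
  closed W -> nbhs e W ->
  W `<=` @er E @^-1` ((@prange E @` K) `&` ~` [set w | K (vpath w)]) ->
  exhaustive_at (es e) (edge_quotient K W).
Proof.
move=> /exhaustive_atP[cK nK exK] cW eW WK.
have quot_mem e' lam : W e' -> prange lam = es e' -> exists2 al,
    edge_quotient K W al & path_comparable al lam.
  move=> We' rlam; have [Ke' nKe'] := WK _ We'.
  have [mu [_ [rmu lmu]]] :=
    is_concat_ex (esym rlam : psource (epath e') = prange lam).
  rewrite pedges_epath /= in lmu.
  have [|al Kal clam] := exK mu; first by rewrite rmu.
  have [alE|[l alE]] := path_comparable_edge clam lmu.
    by case: nKe'; rewrite /= -alE.
  exists (ptail al).
    exists al => //; exists e' => //.
    by rewrite pedges_ptail alE (prange_ptail alE).
  case: clam => _; rewrite /path_comparable pedges_ptail (prange_ptail alE).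
  by rewrite rlam alE lmu !prefix_cons eqxx.
apply/exhaustive_atP; split; first exact: compact_edge_quotient.
  have := local_homeomorphism_nbhs (@es_local_homeomorphism E) eW.
  apply: filterS => _ [e' We' <-].
  have [al Wal [ral _]] := quot_mem e' (vpath (es e')) We' erefl.
  by exists al.
by move=> lam [_ [mu Kmu [e' We' [_ ->]]] rlam]; exact: (quot_mem e').
Qed.

Lemma E0sg_prefix_mem K lam : E0sg (psource lam) ->
  exhaustive_at (prange lam) K ->
  exists2 al, K al & prange al = prange lam /\ prefix (pedges al) (pedges lam).
Proof.
move lE : (pedges lam) => l.
(* [K] is generalised since the induction step replaces it by an edge quotient. *)
elim: l => [|e l IH] in lam lE K * => sglam exK.
  exists lam; last by rewrite lE.
  move: sglam; rewrite (pedges_nil lE) /= => sglam.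
  exact: E0sg_vpath_mem.
rewrite -(pedges_head lE) in exK *.
have [Ke|nKe] := pselect (K (vpath (er e))).
  by exists (vpath (er e)) => //; rewrite pedges_vpath.
have [U eU injU] := local_homeomorphism_inj e (@es_local_homeomorphism E).
have nO := er_continuous (nbhs_setD_vpath exK nKe).
have [W [oW We]] := locally_compact_nbhs_closure (@edge_hausdorff E)
  (@edge_locally_compact E) (filterI eU nO).
rewrite subsetI => -[WU WO].
have exK' : exhaustive_at (es e) (edge_quotient K (closure W)).
  apply: exhaustive_at_edge_quotient => //; first exact: closed_closure.
  by apply: filterS (@subset_closure _ W) _; exact: open_nbhs_nbhs.
have [|||al [mu Kmu [e' We' [muE ral]]] [ral' pal]] :=
  IH (ptail lam) _ (edge_quotient K (closure W)).
- by rewrite pedges_ptail lE.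
- by rewrite psource_ptail.
- by rewrite (prange_ptail lE).
(* Both edges lie in [U], where s is injective, and have the range of [al] as source. *)
have ee' : e' = e.
  apply: injU; rewrite ?inE; [exact: WU|exact: nbhs_singleton|].
  by rewrite -ral ral' (prange_ptail lE).
by exists mu => //; rewrite muE -(pedges_head muE) ee' prefix_cons eqxx.
Qed.

(** * An exhaustive set avoiding a regular vertex *)

Lemma E0rg_exhaustive_at v : E0rg v ->
  exists2 K, exhaustive_at v K & ~ K (vpath v).
Proof.
move=> [[N [oN Nv cN]] nscev].
have nN : nbhs v (N `&` ~` closure (E0sce (E := E))).
  apply: filterI; first exact: open_nbhs_nbhs.
  apply: open_nbhs_nbhs; split=> //.
  by apply: closed_openC; exact: closed_closure.
have [V [oV Vv]] := locally_compact_nbhs_closure (@vertex_hausdorff E)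
  (@vertex_locally_compact E) nN.
rewrite subsetI => -[VN Vsce].
(* [w] is outside [E0sce], hence in the closure of r(E^1). As [N] is a neighbourhood of [w], only
   edges ending in its closure matter, and their ranges form a compact, hence closed, set. *)
have er_sur w : closure V w -> exists2 e, closure V (er e) & er e = w.
  move=> Vw; have cerN : closed (@er E @` (@er E @^-1` closure N)).
    apply: compact_closed; first exact: vertex_hausdorff.
    by apply: continuous_compact cN; exact/continuous_subspaceT/er_continuous.
  suff /cerN[e _ ew] : closure (@er E @` (@er E @^-1` closure N)) w.
    by exists e => //; rewrite ew.
  have clw : closure (range (@er E)) w.
    by apply: contrapT => scew; apply: (Vsce _ Vw); exact: subset_closure.
  move=> B wB; have [_ [[e _ <-] [Be Ne]]] :=
    clw _ (filterI wB (open_nbhs_nbhs (conj oN (VN _ Vw)))).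
  by exists (er e); split=> //; exists e => //; exact: subset_closure.
exists (epath @` (@er E @^-1` closure V)); last first.
  by move=> [e _ /(congr1 (@plen E))].
have cVE : @prange E @` (epath @` (@er E @^-1` closure V)) = closure V.
  apply/seteqP; split=> [_ [_ [e Ve <-] <-]//|w /er_sur[e Ve <-]].
  by exists (epath e) => //; exists e.
apply/exhaustive_atP; rewrite cVE; split.
- apply: continuous_compact.
    exact/continuous_subspaceT/epath_continuous.
  apply: subclosed_compact cN _; last by move=> e /= /VN; exact: subset_closure.
  apply: closed_comp; last exact: closed_closure.
  by move=> e _; exact: er_continuous.
- by apply: filterS (@subset_closure _ V) _; exact: open_nbhs_nbhs.
(* A vertex is extended by an edge from [er_sur]; any other path extends its own first edge. *)
move=> lam Vlam; case lE : (pedges lam) => [|e l].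
  have [e Ve elam] := er_sur _ Vlam.
  by exists (epath e); [exists e | split=> //; rewrite lE pedges_epath].
exists (epath e); first by exists e => //=; rewrite (pedges_head lE).
split; first by rewrite -(pedges_head lE).
by rewrite lE pedges_epath prefix_cons eqxx prefix0s.
Qed.

(** * Comparison of the two kinds of boundary paths *)

Lemma Yeend_infiniteT (mu : infpath E) : Yeend_infinite mu.
Proof.
move=> m K /exhaustive_atP[cK nK exK].
have [n Kn] := compact_plen_bounded cK.
pose v := er (sval mu m); pose s k := mkseq (fun i => sval mu (m + i)%N) k.
(* A segment of length [n] is longer than every path of [K], so a path of [K] comparable with it
   must be an initial part of it. *)
have [lam [rlam lE]] : exists lam, is_path v (s n) lam.
  apply: is_path_ex => [e l|e0 i].
    by case: n {Kn} => // n [<- _]; rewrite addn0.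
  rewrite size_mkseq => ilt; rewrite !nth_mkseq ?(ltnW ilt)// addnS.
  exact: (svalP mu).
have [|al Kal [ral pal]] := exK lam.
  by rewrite rlam; exact: nbhs_singleton.
exists al => //; exists (plen al); split; first by rewrite ral.
have aln := Kn _ Kal.
have {}pal : prefix (pedges al) (s n).
  case/orP: pal; rewrite lE// => /size_prefix.
  by rewrite size_mkseq size_pedges leqNgt aln.
move: pal; rewrite prefixE size_pedges => /eqP <-.
by rewrite /s /mkseq -map_take take_iota (minn_idPl (ltnW aln)).
Qed.

Lemma E0sg_Yeend_finite mu : E0sg (psource mu) -> Yeend_finite mu.
Proof.
move=> sgmu; split=> [m K exK|K]; last exact: E0sg_vpath_mem.
(* What remains of [mu] after [m] edges; its source is still singular. *)
pose lam := iter m ptail mu.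
have lamE : pedges lam = drop m (pedges mu).
  rewrite /lam; elim: (m : nat) => [|k IH] /=; first by rewrite drop0.
  by rewrite pedges_ptail IH -drop1 drop_drop add1n.
have slam : psource lam = psource mu.
  by rewrite /lam; elim: (m : nat) => //= k; rewrite psource_ptail.
have rlam : prange lam = er (pedge m).
  rewrite -(pedges_head (_ : pedges lam = pedge m :: drop m.+1 (pedges mu)))//.
  by rewrite lamE (drop_nth (pedge m)) ?size_pedges// nth_pedges.
have [||al Kal [ral pal]] := @E0sg_prefix_mem K lam; rewrite ?slam ?rlam//.
exists al => //; exists (plen al).
  rewrite -leq_subRL ?(ltnW (ltn_ord m))//.
  by move/size_prefix: pal; rewrite lamE size_drop !size_pedges.
split; first by rewrite ral.
by move: pal; rewrite lamE prefixE size_pedges => /eqP.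
Qed.

Lemma Yeend_finite_E0sg mu : Yeend_finite mu -> E0sg (psource mu).
Proof. by move=> [_ Ymu] /E0rg_exhaustive_at[K /Ymu]. Qed.

End BoundaryPaths.

Theorem proposition4p6 (E : topological_graph) : boundary E = boundaryY E.
Proof.
apply/seteqP; split=> -[mu|mu].
- by move=> [[x _] //|[x sgx [<-]]]; exact: E0sg_Yeend_finite.
- by move=> _; exact: Yeend_infiniteT.
- by move=> /Yeend_finite_E0sg sgmu; right; exists mu.
- by move=> _; left; exists mu.
Qed.
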